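(* Let $n\ge 2$ and let $k$ be a positive integer dividing $n$. Let $f=(f^m)_{m\in\mathbb{N}}$ be a family of functions $f^m:\{0,1\}^m\to\mathbb{R}_{\ge 0}$ such that $1^m$ is the unique optimum of $f^m$. Define $LO_k^f:\{0,1\}^n\to\mathbb{R}_{\ge0}$ by $$LO_k^f(x)=\sum_{i=0}^{n/k-1} f^k(x_{ik}x_{ik+1}\dots x_{ik+k-1})\cdot\prod_{j=0}^{ik-1}x_j .$$ Let $T$ be the run time of the (1+1) EA (with mutation probability $1/n$) maximizing $LO_k^f$ on bit strings of length $n$, and let $T_k^n$ be the run time of the (1+1) EA maximizing $f^k$ on bit strings of length $k$ but with bit flip probability $1/n$. Then $$E(T)=E(T_k^n)\,\frac{\left(\frac{n}{n-1}\right)^n-1}{\left(\frac{n}{n-1}\right)^k-1}\in\Theta\!\left(E(T_k^n)\frac{n}{k}\right).$$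
   Context: The (1+1) EA with bit flip probability $p$ maximizing $g:\{0,1\}^m\to\mathbb{R}$: start with $x$ drawn uniformly at random from $\{0,1\}^m$; in each iteration create $y$ by flipping each bit of $x$ independently with probability $p$, and set $x\gets y$ if $g(y)\ge g(x)$. The run time is the number of iterations until the optimum is first the current solution. *)

(* Defs.v *)
From HB Require Import structures.
From mathcomp Require Import all_boot all_order all_algebra.
From mathcomp Require Import all_classical all_reals.
From mathcomp Require Import ereal sequences.

Set Implicit Arguments.
Unset Strict Implicit.
Unset Printing Implicit Defensive.

Import Order.TTheory GRing.Theory Num.Theory.
Local Open Scope ring_scope.

Section EA.
Variable R : realType.

Definition bits (m : nat) := {ffun 'I_m -> bool}.

Definition ones (m : nat) : bits m := [ffun => true].

(* the j-th bit as a function of a natural index (false outside range) *)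
Definition bit (m : nat) (x : bits m) (j : nat) : bool :=
  match insub j with Some i => x i | None => false end.

Definition block (n k : nat) (x : bits n) (i : nat) : bits k :=
  [ffun j : 'I_k => bit x (i * k + j)].

Definition LO (n k : nat) (f : forall m, bits m -> R) (x : bits n) : R :=
  \sum_(i < n %/ k) f k (block k x i) * \prod_(j < i * k) (bit x j)%:R.

Definition hamming (m : nat) (x y : bits m) : nat := #|[set i | x i != y i]|.

Definition mut_prob (m : nat) (p : R) (x z : bits m) : R :=
  p ^+ hamming x z * (1 - p) ^+ (m - hamming x z).

Definition ea_kernel (m : nat) (p : R) (g : bits m -> R) (x y : bits m) : R :=
  \sum_(z : bits m) mut_prob p x z * ((if g x <= g z then z else x) == y)%:R.

Definition is_opt (m : nat) (g : bits m -> R) (x : bits m) : bool :=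
  [forall y, g y <= g x].

(* q t x = Pr[ X_t = x and no optimum among X_0, ..., X_t ] *)
Fixpoint not_hit (m : nat) (p : R) (g : bits m -> R) (t : nat) (y : bits m) : R :=
  match t with
  | 0 => (2 ^+ m)^-1 * (~~ is_opt g y)%:R
  | t'.+1 => (~~ is_opt g y)%:R *
             \sum_(x : bits m) not_hit p g t' x * ea_kernel p g x y
  end.

(* Pr[ T = t ], T = first time the current solution is an optimum,
   X_0 uniform on {0,1}^m *)
Definition hit_prob (m : nat) (p : R) (g : bits m -> R) (t : nat) : R :=
  match t with
  | 0 => \sum_(y : bits m) (2 ^+ m)^-1 * (is_opt g y)%:R
  | t'.+1 => \sum_(y : bits m) (is_opt g y)%:R *
             \sum_(x : bits m) not_hit p g t' x * ea_kernel p g x y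
  end.

Definition expected_runtime (m : nat) (p : R) (g : bits m -> R) : \bar R :=
  (\sum_(0 <= t <oo) ((t%:R * hit_prob p g t)%:E))%E.

End EA.

Arguments LO {R} n k f x.
Arguments expected_runtime {R m} p g.

(* Main.v *)
Require Import Defs.
From HB Require Import structures.
From mathcomp Require Import all_boot all_order all_algebra.
From mathcomp Require Import all_classical all_reals.
From mathcomp Require Import topology normedtype ereal sequences.
From mathcomp Require Import ring lra zify.
Import Order.TTheory GRing.Theory Num.Theory.
Import numFieldNormedType.Exports.
Local Open Scope ring_scope.

(** Call a block critical if it is the first one that is not all ones.  As
   [f k] lies in [0, f k 1^k] with a unique maximum, an offspring that damages
   one of the [j] completed blocks is rejected, and otherwise acceptance is
   decided by the critical block alone.  So while [j] blocks are completed the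
   critical block performs the (1+1) EA on [f k], slowed down by the factor
   [q_j = (1 - 1/n)^(jk)], and the bits behind it, which never influence
   acceptance, stay uniform.  The phase hence costs [E(T_k^n) / q_j] in
   expectation, and the geometric sum over [j < n/k] is the claimed factor.

   Uniformity is expressed as invariance of the sub-distribution of the current
   solution under flipping any set of bits behind the critical block; the
   expectations are computed with a potential function whose one-step
   decrease, averaged over that sub-distribution, equals 1. *)

(** * The mutation and selection kernels *)

Lemma mut_prob_prod {R : realType} {m : nat} (p : R) (x z : bits m) :
  mut_prob p x z = \prod_i (if x i != z i then p else 1 - p).
Proof.
rewrite (bigID (fun i => x i != z i)) /= /mut_prob /hamming; congr (_ * _).
  rewrite (eq_bigr (fun=> p)) => [|i ->//].
  by rewrite -prodr_const; apply: eq_bigl => i; rewrite inE.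
rewrite (eq_bigr (fun=> 1 - p)) => [|i /negbTE ->//].
rewrite prodr_const; congr (_ ^+ _).
rewrite -[X in (X - _)%N](card_ord m) -(cardsC [set i | x i != z i]) addKn.
by apply: eq_card => i; rewrite !inE.
Qed.

Lemma sum_mut_prod {R : realType} {m : nat} (p : R) (x : bits m)
    (u : 'I_m -> bool -> R) :
  \sum_z mut_prob p x z * \prod_i u i (z i)
  = \prod_i \sum_v (if x i != v then p else 1 - p) * u i v.
Proof.
rewrite bigA_distr_bigA; apply: eq_bigr => z _.
by rewrite mut_prob_prod -big_split.
Qed.

Lemma sum_mut_prob {R : realType} {m : nat} (p : R) (x : bits m) :
  \sum_z mut_prob p x z = 1.
Proof.
transitivity (\sum_z mut_prob p x z * \prod_(i < m) (1 : R)).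
  by apply: eq_bigr => z _; rewrite big1_eq mulr1.
rewrite (sum_mut_prod p x (fun _ _ => 1)); apply: big1 => i _.
by rewrite big_bool !mulr1; case: (x i) => /=; ring.
Qed.

Lemma mut_prob_ge0 {R : realType} {m : nat} (p : R) (x z : bits m) :
  0 < p < 1 -> 0 <= mut_prob p x z.
Proof.
by move=> /andP[p0 p1]; rewrite mulr_ge0 ?exprn_ge0 ?subr_ge0 // ltW.
Qed.

Lemma mut_prob_lb {R : realType} {m : nat} (p : R) (x z : bits m) :
  0 < p < 1 -> (p * (1 - p)) ^+ m <= mut_prob p x z.
Proof.
move=> /andP[p0 p1]; have hm : (hamming x z <= m)%N.
  by rewrite /hamming -[leqRHS](card_ord m) max_card.
have q0 : 0 < 1 - p by rewrite subr_gt0.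
rewrite exprMn ler_pM ?exprn_ge0 ?(ltW p0) ?(ltW q0) //.
  by rewrite ler_wiXn2l // ltW.
by rewrite ler_wiXn2l ?leq_subr ?(ltW q0) // gerBl ltW.
Qed.

Lemma ea_kernelE {R : realType} {m : nat} (p : R) (g phi : bits m -> R)
    (x : bits m) :
  \sum_y ea_kernel p g x y * phi y
  = \sum_z mut_prob p x z * phi (if g x <= g z then z else x).
Proof.
under eq_bigr do rewrite mulr_suml.
rewrite exchange_big; apply: eq_bigr => z _ /=.
rewrite (bigD1 (if g x <= g z then z else x)) //= eqxx mulr1 big1 ?addr0 //.
by move=> y /negbTE; rewrite eq_sym => ->; rewrite mulr0 mul0r.
Qed.

Lemma ea_kernel_drift {R : realType} {m : nat} (p : R) (g phi : bits m -> R)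
    (x : bits m) :
  \sum_y ea_kernel p g x y * phi y - phi x
  = \sum_z mut_prob p x z * ((g x <= g z)%R%:R * (phi z - phi x)).
Proof.
rewrite ea_kernelE -[phi x in LHS]mul1r -[X in _ - X * _](sum_mut_prob p x).
rewrite mulr_suml -sumrB.
by apply: eq_bigr => z _; case: (g x <= g z)%R => /=; ring.
Qed.

Lemma ea_kernel_ge0 {R : realType} {m : nat} (p : R) (g : bits m -> R)
    (x y : bits m) : 0 < p < 1 -> 0 <= ea_kernel p g x y.
Proof.
by move=> p01; apply: sumr_ge0 => z _; rewrite mulr_ge0 ?ler0n ?mut_prob_ge0.
Qed.

Lemma sum_ea_kernel {R : realType} {m : nat} (p : R) (g : bits m -> R)
    (x : bits m) : \sum_y ea_kernel p g x y = 1.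
Proof.
rewrite -[RHS](sum_mut_prob p x).
have := ea_kernelE p g (fun=> 1) x.
under eq_bigr do rewrite mulr1.
by move=> ->; apply: eq_bigr => z _; rewrite mulr1.
Qed.

Lemma ea_kernel_nonopt_le {R : realType} {m : nat} (p : R) (g : bits m -> R)
    (o x : bits m) : 0 < p < 1 -> is_opt g o ->
  \sum_y (~~ is_opt g y)%:R * ea_kernel p g x y <= 1 - (p * (1 - p)) ^+ m.
Proof.
move=> p01 opto; rewrite lerBrDr -[leRHS](sum_ea_kernel p g x).
rewrite [leRHS](bigD1 o) //= [X in X + _](bigD1 o) //= opto mul0r add0r [leLHS]addrC.
rewrite lerD //.
  apply: le_trans (mut_prob_lb p x o p01) _.
  rewrite /ea_kernel (bigD1 o) //= (forallP opto) eqxx mulr1 lerDl.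
  by apply: sumr_ge0 => z _; rewrite mulr_ge0 ?ler0n ?mut_prob_ge0.
apply: ler_sum => y _; case: (is_opt g y) => /=; last by rewrite mul1r.
by rewrite mul0r ea_kernel_ge0.
Qed.

(** * Run time from a potential function *)

Lemma not_hit_ge0 {R : realType} {m : nat} (p : R) (g : bits m -> R) t x :
  0 < p < 1 -> 0 <= not_hit p g t x.
Proof.
move=> p01; elim: t x => [|t IH] x /=.
  by rewrite mulr_ge0 ?invr_ge0 ?exprn_ge0 ?ler0n.
rewrite mulr_ge0 ?ler0n //; apply: sumr_ge0 => y _.
by rewrite mulr_ge0 ?ea_kernel_ge0.
Qed.

Lemma not_hit_opt {R : realType} {m : nat} (p : R) (g : bits m -> R) t x :
  is_opt g x -> not_hit p g t x = 0.
Proof. by case: t => [|t] /= ->; rewrite ?mulr0 ?mul0r. Qed.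

Lemma hit_prob_ge0 {R : realType} {m : nat} (p : R) (g : bits m -> R) t :
  0 < p < 1 -> 0 <= hit_prob p g t.
Proof.
move=> p01; case: t => [|t] /=; apply: sumr_ge0 => y _.
  by rewrite mulr_ge0 ?invr_ge0 ?exprn_ge0 ?ler0n.
rewrite mulr_ge0 ?ler0n //; apply: sumr_ge0 => x _.
by rewrite mulr_ge0 ?ea_kernel_ge0 ?not_hit_ge0.
Qed.

Lemma hit_probS {R : realType} {m : nat} (p : R) (g : bits m -> R) t :
  hit_prob p g t.+1 = \sum_x not_hit p g t x - \sum_x not_hit p g t.+1 x.
Proof.
apply/eqP; rewrite eq_sym subr_eq /= -big_split /=; apply/eqP.
under [RHS]eq_bigr => y _.
  have -> : forall s : R, (is_opt g y)%:R * s + (~~ is_opt g y)%:R * s = s.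
    by move=> s; case: (is_opt g y) => /=; ring.
  over.
rewrite exchange_big /=; apply: eq_bigr => x _.
by rewrite -mulr_sumr sum_ea_kernel mulr1.
Qed.

Lemma sum_time_hit_prob {R : realType} {m : nat} (p : R) (g : bits m -> R) n :
  \sum_(0 <= t < n.+1) t%:R * hit_prob p g t
  = \sum_(0 <= t < n) \sum_x not_hit p g t x - n%:R * \sum_x not_hit p g n x.
Proof.
elim: n => [|n IH]; first by rewrite big_nat1 big_nil !mul0r subr0.
rewrite big_nat_recr // IH hit_probS [in RHS]big_nat_recr //=.
set a := \sum_(_ <= _ < _) _; set b := \sum_x not_hit p g n x.
by rewrite -natr1; set c := \sum_(_ : _) _; ring.
Qed.

Lemma not_hit_mass_le {R : realType} {m : nat} (p : R) (g : bits m -> R)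
    (o : bits m) n : 0 < p < 1 -> is_opt g o ->
  \sum_x not_hit p g n x <= (1 - (p * (1 - p)) ^+ m) ^+ n.
Proof.
move=> p01 opto; set d := 1 - _.
have d0 : 0 <= d.
  apply: le_trans (ea_kernel_nonopt_le p g o o p01 opto).
  by apply: sumr_ge0 => y _; rewrite mulr_ge0 ?ler0n ?ea_kernel_ge0.
elim: n => [|n IH].
  rewrite expr0 /=; apply: (@le_trans _ _ (\sum_(x : bits m) (2 ^+ m)^-1)).
    apply: ler_sum => x _.
    by rewrite ler_piMr ?invr_ge0 ?exprn_ge0 // lern1 leq_b1.
  rewrite sumr_const card_ffun card_bool card_ord -[_ *+ _]mulr_natr natrX.
  by rewrite mulVf // expf_neq0 // pnatr_eq0.
rewrite exprS /=; apply: le_trans (ler_wpM2l d0 IH).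
under eq_bigr do rewrite mulr_sumr.
rewrite exchange_big mulr_sumr; apply: ler_sum => x _ /=.
under eq_bigr do rewrite mulrCA.
rewrite -mulr_sumr mulrC ler_wpM2r ?not_hit_ge0 //.
exact: ea_kernel_nonopt_le p01 opto.
Qed.

Lemma cvg_natmul_geometric {R : realType} (r : R) : 0 <= r < 1 ->
  ((fun n : nat => n%:R * r ^+ n) @ \oo --> (0 : R))%classic.
Proof.
move=> /andP[r0 r1]; pose s := (1 + r) / 2.
have s0 : 0 < s by rewrite /s; lra.
have s1 : s < 1 by rewrite /s; lra.
have rs : r <= s ^+ 2 by rewrite /s; nra.
have bern n : n%:R * (1 - s) * s ^+ n <= 1 - s ^+ n.
  elim: n => [|n IH]; first by rewrite !mul0r expr0 subrr.
  have sn0 : 0 <= s ^+ n by rewrite exprn_ge0 // ltW.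
  have n0 : 0 <= n%:R :> R by [].
  rewrite exprS -natr1; set a := s ^+ n in IH sn0 *; set N := n%:R in IH n0 *.
  have : s * (N * (1 - s) * a) <= s * (1 - a) by rewrite ler_wpM2l // ltW.
  have : 0 <= (1 - s) * (1 - s * a).
    by rewrite mulr_ge0 ?subr_ge0 ?(ltW s1) // /a -exprS exprn_ile1 ?ltW //.
  by lra.
apply: (@squeeze_cvgr _ _ _ _ (fun=> 0) (geometric (1 - s)^-1 s)).
- near=> n; apply/andP; split; first by rewrite mulr_ge0 ?exprn_ge0.
  have sn0 : 0 <= s ^+ n by rewrite exprn_ge0 // ltW.
  apply: (@le_trans _ _ (n%:R * s ^+ n * s ^+ n)).
    rewrite -mulrA ler_wpM2l // -expr2 -exprM mulnC exprM.
    by rewrite lerXn2r ?nnegrE ?exprn_ge0 ?(ltW s0).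
  rewrite /= ler_wpM2r // -[leRHS]mul1r ler_pdivlMr ?subr_gt0 //.
  have := bern n; nra.
- exact: cvg_cst.
- by apply: cvg_geometric; rewrite ger0_norm // ltW.
Unshelve. all: by end_near. Qed.

(* Along the run, the expectation of [Phi] restricted to the event that no
   optimum was found drops by exactly the mass of this event. *)
Lemma expected_runtime_potential {R : realType} {m : nat} (p : R)
    (g Phi : bits m -> R) (o : bits m) :
  0 < p < 1 -> is_opt g o ->
  (forall x, is_opt g x -> Phi x = 0) ->
  (forall t, \sum_x not_hit p g t x * (Phi x - \sum_y ea_kernel p g x y * Phi y)
             = \sum_x not_hit p g t x) ->
  expected_runtime p g = ((2 ^+ m)^-1 * \sum_x Phi x)%:E.
Proof.
move=> p01 opto Phi0 drift.
pose e t := \sum_x not_hit p g t x * Phi x.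
pose S t := \sum_x not_hit p g t x.
set rho := 1 - (p * (1 - p)) ^+ m.
have rho01 : 0 <= rho < 1.
  apply/andP; split.
    apply: le_trans (ea_kernel_nonopt_le p g o o p01 opto).
    by apply: sumr_ge0 => y _; rewrite mulr_ge0 ?ler0n ?ea_kernel_ge0.
  case/andP: p01 => p0 p1.
  by rewrite /rho gtrBl exprn_gt0 // mulr_gt0 // subr_gt0.
have S0 t : 0 <= S t by apply: sumr_ge0 => x _; exact: not_hit_ge0.
have Sle t : S t <= rho ^+ t by exact: not_hit_mass_le opto.
have eS t : e t.+1 = e t - S t.
  rewrite /S -drift /e -sumrB.
  under [RHS]eq_bigr do rewrite -mulrBr subKr mulr_sumr.
  rewrite exchange_big; apply: eq_bigr => y _ /=.
  under [RHS]eq_bigr do rewrite mulrA.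
  rewrite -mulr_suml; have [/Phi0 ->|] := boolP (is_opt g y).
    by rewrite !mulr0.
  by rewrite mul1r.
have sumS n : \sum_(0 <= t < n) S t = e 0%N - e n.
  elim: n => [|n IH]; first by rewrite big_nil subrr.
  by rewrite big_nat_recr //= IH eS; ring.
have e0 : e 0%N = (2 ^+ m)^-1 * \sum_x Phi x.
  rewrite /e mulr_sumr; apply: eq_bigr => x _ /=.
  by have [/Phi0 ->|] := boolP (is_opt g x); rewrite ?mulr0 ?mulr1.
pose M := \sum_x `|Phi x|.
have M0 : 0 <= M by apply: sumr_ge0.
have ele n : `|e n| <= M * S n.
  apply: le_trans (ler_norm_sum _ _ _) _; rewrite mulr_sumr.
  apply: ler_sum => x _; rewrite normrM mulrC.
  rewrite [`|not_hit _ _ _ _|]ger0_norm ?not_hit_ge0 //.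
  by rewrite ler_wpM2r ?not_hit_ge0 // /M (bigD1 x) //= lerDl sumr_ge0.
have rhoabs : `|rho| < 1 by rewrite ger0_norm; case/andP: rho01.
have cvge : (e @ \oo --> (0 : R))%classic.
  apply: (@squeeze_cvgr _ _ _ _ (geometric (- M) rho) (geometric M rho)).
  - near=> n; rewrite /= mulNr -ler_norml; apply: le_trans (ele n) _.
    by rewrite ler_wpM2l.
  - exact: cvg_geometric.
  - exact: cvg_geometric.
have cvgS : ((fun n => n%:R * S n) @ \oo --> (0 : R))%classic.
  apply: (@squeeze_cvgr _ _ _ _ (fun=> 0) (fun n => n%:R * rho ^+ n)).
  - by near=> n; rewrite mulr_ge0 //= ler_wpM2l.
  - exact: cvg_cst.
  - exact: cvg_natmul_geometric.
have partial n : (\sum_(0 <= t < n.+1) (t%:R * hit_prob p g t)%:E)%E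
    = (e 0%N - e n - n%:R * S n)%:E.
  by rewrite sumEFin sum_time_hit_prob sumS.
rewrite /expected_runtime -e0; apply/cvg_lim => //.
rewrite -cvg_shiftS; apply: cvg_EFin.
  by near=> n; rewrite /= partial.
rewrite (_ : fine \o _ = fun n => e 0%N - e n - n%:R * S n); last first.
  by apply/funext => n; rewrite /= partial.
rewrite -[X in (_ --> X)%classic]subr0; apply: cvgB => //.
rewrite -[X in (_ --> X)%classic]subr0; apply: cvgB => //.
exact: cvg_cst.
Unshelve. all: by end_near. Qed.

Lemma expected_runtime_ge0 {R : realType} {m : nat} (p : R) (g : bits m -> R) :
  0 < p < 1 -> (0 <= expected_runtime p g)%E.
Proof.
move=> p01; apply: nneseries_ge0 => t _ _.
by rewrite lee_fin mulr_ge0 ?hit_prob_ge0.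
Qed.

Lemma linear_system_solvable {F : fieldType} (T : finType) (A : T -> T -> F)
    (u : T -> F) :
  (forall v : T -> F, (forall x, \sum_y A x y * v y = 0) -> v =1 fun=> 0) ->
  exists v : T -> F, forall x, \sum_y A x y * v y = u x.
Proof.
move=> injA.
pose M := \matrix_(i < #|T|, j < #|T|) A (enum_val j) (enum_val i).
have mulM (w : 'rV[F]_#|T|) j :
    (w *m M) 0 j = \sum_y A (enum_val j) y * w 0 (enum_rank y).
  rewrite mxE (reindex enum_rank) /=; last first.
    by apply: onW_bij; exact: enum_rank_bij.
  by apply: eq_bigr => y _; rewrite mxE enum_rankK mulrC.
have uM : M \in unitmx.
  rewrite -row_free_unit; apply: inj_row_free => w wM.
  apply/rowP => i; rewrite mxE -(enum_valK i).
  apply: (injA (fun y => w 0 (enum_rank y))) => x.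
  by have := mulM w (enum_rank x); rewrite wM mxE enum_rankK => <-.
pose w := (\row_i u (enum_val i)) *m invmx M.
exists (fun y => w 0 (enum_rank y)) => x.
by have := mulM w (enum_rank x); rewrite enum_rankK mulmxKV // mxE enum_rankK.
Qed.

(* Uniqueness of the solution: a bounded function fixed by the kernel killed
   at the optima is contracted in the supremum norm, hence zero. *)
Lemma hitting_time_exists {R : realType} {m : nat} (p : R) (g : bits m -> R)
    (o : bits m) : 0 < p < 1 -> is_opt g o ->
  exists h : bits m -> R, forall x,
    h x = (~~ is_opt g x)%:R * (1 + \sum_y ea_kernel p g x y * h y).
Proof.
move=> p01 opto.
pose A x y := (x == y)%:R - (~~ is_opt g x)%:R * ea_kernel p g x y.
have sumA (v : bits m -> R) x : \sum_y A x y * v y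
    = v x - (~~ is_opt g x)%:R * \sum_y ea_kernel p g x y * v y.
  under eq_bigr do rewrite mulrBl -mulrA.
  rewrite sumrB -mulr_sumr (bigD1 x) //= eqxx mul1r big1 ?addr0 // => y.
  by rewrite eq_sym => /negbTE ->; rewrite mul0r.
have [v Av0|h hE] :=
    linear_system_solvable (bits m) A (fun x => (~~ is_opt g x)%:R).
  have vE x : v x = (~~ is_opt g x)%:R * \sum_y ea_kernel p g x y * v y.
    by apply/eqP; rewrite -subr_eq0 -sumA Av0.
  pose x := [arg max_(x > o) `|v x|]%O.
  have xmax y : `|v y| <= `|v x|.
    by rewrite /x; case: Order.TotalTheory.arg_maxP => // i _; apply.
  have : `|v x| <= `|v x| * (1 - (p * (1 - p)) ^+ m).
    rewrite {1}vE normrM; apply: (@le_trans _ _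
        (\sum_y (~~ is_opt g y)%:R * ea_kernel p g x y * `|v x|)).
      apply: (@le_trans _ _ (1 * `|\sum_y ea_kernel p g x y * v y|)).
        by rewrite ler_wpM2r // normr_nat lern1 leq_b1.
      rewrite mul1r; apply: le_trans (ler_norm_sum _ _ _) _.
      apply: ler_sum => y _; rewrite normrM ger0_norm ?ea_kernel_ge0 //.
      have [opty|_] := boolP (is_opt g y).
        by rewrite vE opty !mul0r normr0 mulr0.
      by rewrite mul1r ler_wpM2l ?ea_kernel_ge0.
    rewrite -mulr_suml mulrC ler_wpM2l //.
    exact: ea_kernel_nonopt_le p01 opto.
  have d0 : 0 < (p * (1 - p)) ^+ m.
    by case/andP: p01 => ? ?; rewrite exprn_gt0 // mulr_gt0 // subr_gt0.
  move=> vle y; apply/eqP; rewrite -normr_le0; apply: le_trans (xmax y) _.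
  by rewrite -(pmulr_lle0 _ d0); nra.
exists h => x; have := hE x; rewrite sumA => /eqP.
by rewrite subr_eq => /eqP ->; ring.
Qed.

(** * Prefixes, blocks and bitwise exclusive or *)

Lemma prod_natb {R : comPzRingType} {I : finType} (B : pred I) :
  \prod_i (B i)%:R = [forall i, B i]%:R :> R.
Proof.
have [/forallP BT|/forallPn[i /negbTE Bi]] := boolP [forall i, B i].
  by rewrite big1 // => i _; rewrite BT.
by rewrite (bigD1 i) //= Bi mul0r.
Qed.

Lemma bitE {m : nat} (x : bits m) (i : 'I_m) : bit x i = x i.
Proof. by rewrite /bit valK. Qed.

Lemma bit_out {m : nat} (x : bits m) j : (m <= j)%N -> bit x j = false.
Proof. by move=> mj; rewrite /bit insubF // ltnNge mj. Qed.

Lemma bitP {m : nat} (x y : bits m) : (forall j, (j < m)%N -> bit x j = bit y j) ->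
  x = y.
Proof. by move=> xy; apply/ffunP => i; rewrite -!bitE xy. Qed.

Lemma bit_ones m j : bit (ones m) j = (j < m)%N.
Proof.
have [jm|mj] := ltnP j m; last by rewrite bit_out.
by rewrite (bitE _ (Ordinal jm)) ffunE.
Qed.

Definition bxor {m : nat} (x c : bits m) : bits m := [ffun i => x i (+) c i].

Lemma bit_xor {m : nat} (x c : bits m) j :
  bit (bxor x c) j = bit x j (+) bit c j.
Proof.
have [jm|mj] := ltnP j m; last by rewrite !bit_out.
by rewrite !(bitE _ (Ordinal jm)) ffunE.
Qed.

Lemma bxorK {m : nat} (c : bits m) : involutive (bxor^~ c).
Proof. by move=> x; apply/ffunP => i; rewrite !ffunE addbK. Qed.

Lemma bxorC {m : nat} (x c : bits m) : bxor x c = bxor c x.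
Proof. by apply/ffunP => i; rewrite !ffunE addbC. Qed.

Lemma mut_prob_xor {R : realType} {m : nat} (p : R) (x z c : bits m) :
  mut_prob p (bxor x c) (bxor z c) = mut_prob p x z.
Proof.
rewrite !mut_prob_prod; apply: eq_bigr => i _.
by rewrite !ffunE (inj_eq (@addIb _)).
Qed.

Lemma block_bit {n : nat} (k : nat) (x : bits n) i j : (j < k)%N ->
  bit (block k x i) j = bit x (i * k + j).
Proof. by move=> jk; rewrite (bitE _ (Ordinal jk)) ffunE. Qed.

Definition prefix_ones {n : nat} (k : nat) (x : bits n) (i : nat) : bool :=
  [forall j : 'I_(i * k), bit x j].

Lemma prefix_onesP {n : nat} (k : nat) (x : bits n) i :
  reflect (forall j, (j < i * k)%N -> bit x j) (prefix_ones k x i).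
Proof.
apply: (iffP forallP) => [H j jik|H j]; first exact: (H (Ordinal jik)).
exact: H.
Qed.

Lemma prefix_ones_le {n : nat} (k : nat) (x : bits n) i j : (i <= j)%N ->
  prefix_ones k x j -> prefix_ones k x i.
Proof.
move=> ij /prefix_onesP H; apply/prefix_onesP => l li; apply: H.
by apply: leq_trans li _; rewrite leq_mul2r ij orbT.
Qed.

Lemma prefix_ones0 {n : nat} (k : nat) (x : bits n) : prefix_ones k x 0.
Proof. by apply/prefix_onesP. Qed.

Lemma prefix_onesS {n : nat} (k : nat) (x : bits n) i :
  prefix_ones k x i.+1 = prefix_ones k x i && (block k x i == ones k).
Proof.
apply/idP/andP => [H|[/prefix_onesP H /eqP B]].
  split; first exact: prefix_ones_le H.
  apply/eqP/bitP => j jk; rewrite block_bit // bit_ones jk.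
  by apply: (prefix_onesP _ _ _ H); rewrite mulSn addnC ltn_add2r.
apply/prefix_onesP => j; rewrite mulSn addnC => jb.
have [/H//|ij] := ltnP j (i * k).
have jk : (j - i * k < k)%N by lia.
by have := block_bit k x i _ jk; rewrite B bit_ones jk subnKC // => <-.
Qed.

Lemma prefix_ones_xor {n : nat} (k : nat) (x c : bits n) i :
  (forall j, (j < i * k)%N -> bit c j = false) ->
  prefix_ones k (bxor x c) i = prefix_ones k x i.
Proof.
move=> c0; apply/prefix_onesP/prefix_onesP => H j jik; have := H j jik;
  by rewrite bit_xor c0 // addbF.
Qed.

Lemma prefix_ones_level {n : nat} (k : nat) (x : bits n) i :
  ~~ prefix_ones k x i ->
  exists2 j, (j < i)%N & prefix_ones k x j && ~~ prefix_ones k x j.+1.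
Proof.
elim: i => [|i IH]; first by rewrite prefix_ones0.
have [Hi HSi|/IH[j ji Hj] _] := boolP (prefix_ones k x i).
  by exists i => //; rewrite Hi.
by exists j => //; apply: ltnW.
Qed.

Definition embed {n : nat} (k j : nat) (c : bits k) : bits n :=
  [ffun i : 'I_n => (j * k <= i)%N && bit c (i - j * k)].

Lemma embed_low {n k : nat} j (c : bits k) l : (l < j * k)%N ->
  bit (embed k j c : bits n) l = false.
Proof.
move=> lj; have [ln|nl] := ltnP l n; last by rewrite bit_out.
by rewrite (bitE _ (Ordinal ln)) ffunE /= leqNgt lj.
Qed.

Lemma block_xor_embed {n k : nat} j (x : bits n) (c : bits k) :
  (j.+1 * k <= n)%N ->
  block k (bxor x (embed k j c)) j = bxor (block k x j) c.
Proof.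
move=> jn; apply: bitP => l lk; rewrite bit_xor !block_bit // bit_xor.
have jln : (j * k + l < n)%N by apply: leq_trans jn; rewrite mulSn; lia.
congr (_ (+) _); rewrite (bitE _ (Ordinal jln)) ffunE /= leq_addr.
by rewrite addKn.
Qed.

Lemma sum_block_uniform {R : realType} {n k : nat} (j : nat) (W : bits n -> R)
    (h : bits k -> R) : (j.+1 * k <= n)%N ->
  (forall c z, W (bxor z (embed k j c)) = W z) ->
  \sum_z W z * h (block k z j)
  = (\sum_z W z) * ((2 ^+ k)^-1 * \sum_b h b).
Proof.
move=> jn Winv; have k2 : (2 ^+ k : R) != 0 by rewrite expf_neq0 ?pnatr_eq0.
apply: (mulfI k2); rewrite mulrCA mulVKf //.
transitivity (\sum_(c : bits k) \sum_z W z * h (block k z j)).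
  rewrite sumr_const card_ffun card_bool card_ord -[RHS]mulr_natl natrX.
  by [].
transitivity (\sum_(c : bits k) \sum_z W z * h (bxor (block k z j) c)).
  apply: eq_bigr => c _.
  rewrite (reindex_inj (can_inj (bxorK (embed k j c)))) /=.
  by apply: eq_bigr => z _; rewrite Winv block_xor_embed.
rewrite exchange_big mulr_suml; apply: eq_bigr => z _ /=.
rewrite -mulr_sumr; congr (_ * _).
rewrite [RHS](reindex_inj (can_inj (bxorK (block k z j)))) /=.
by apply: eq_bigr => c _; rewrite bxorC.
Qed.

Lemma sum_mut_block {R : realType} {n k : nat} (p : R) (x : bits n) (j : nat)
    (G : bits k -> R) : (j.+1 * k <= n)%N -> prefix_ones k x j ->
  \sum_z mut_prob p x z * ((prefix_ones k z j)%:R * G (block k z j))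
  = (1 - p) ^+ (j * k) * \sum_b mut_prob p (block k x j) b * G b.
Proof.
move=> jn xj.
pose u (b : bits k) (i : nat) (v : bool) := if (i < j * k)%N then v
  else if (i < j * k + k)%N then v == bit b (i - j * k) else true.
have uE (b : bits k) (z : bits n) :
    prefix_ones k z j && (block k z j == b) = [forall i, u b (val i) (z i)].
  apply/andP/forallP => [[/prefix_onesP zj /eqP zb] i|H].
    rewrite /u; case: ltnP => [/zj|ji]; first by rewrite bitE.
    case: ltnP => // ijk; rewrite -zb block_bit ?subnKC ?bitE //.
    by lia.
  split.
    apply/prefix_onesP => l lj; have ln : (l < n)%N by rewrite mulSn in jn; lia.
    by have := H (Ordinal ln); rewrite /u /= lj (bitE _ (Ordinal ln)).
  apply/eqP/bitP => l lk; rewrite block_bit //.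
  have ln : (j * k + l < n)%N by rewrite mulSn in jn; lia.
  have := H (Ordinal ln); rewrite /u /= ltnNge leq_addr /= ltn_add2l lk addKn.
  by rewrite (bitE _ (Ordinal ln)) => /eqP.
have sumb (z : bits n) : (prefix_ones k z j)%:R * G (block k z j)
    = \sum_b G b * \prod_i (u b (val i) (z i))%:R.
  under eq_bigr do rewrite prod_natb -uE.
  rewrite (bigD1 (block k z j)) //= eqxx andbT big1 ?addr0; first exact: mulrC.
  by move=> b; rewrite eq_sym => /negbTE ->; rewrite andbF mulr0.
under eq_bigr do rewrite sumb mulr_sumr.
rewrite exchange_big mulr_sumr; apply: eq_bigr => b _ /=.
under eq_bigr do rewrite mulrCA.
rewrite -mulr_sumr (sum_mut_prod p x (fun i v => (u b (val i) v)%:R)).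
rewrite [RHS]mulrA [RHS]mulrC; congr (_ * _).
pose F i : R := if (i < j * k)%N then 1 - p
  else if (i < j * k + k)%N then
    (if bit x i != bit b (i - j * k) then p else 1 - p) else 1.
transitivity (\prod_(i < n) F i).
  apply: eq_bigr => i _; rewrite big_bool /= /u /F -bitE.
  case: ltnP => [ij|ji]; first by rewrite (prefix_onesP _ _ _ xj) //=; ring.
  case: ltnP => _; last by case: (bit x i) => /=; ring.
  by case: (bit x i); case: (bit b _) => /=; ring.
rewrite -(big_mkord xpredT F) (big_cat_nat (n := (j * k)%N)) //=; last first.
  by rewrite mulSn in jn; lia.
congr (_ * _).
  rewrite (eq_big_nat _ _ (F2 := fun=> 1 - p)) ?prodr_const_nat ?subn0 //.
  by move=> i /andP[_ ij]; rewrite /F ij.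
rewrite (big_cat_nat (n := (j * k + k)%N)) ?leq_addr //=; last first.
  by rewrite mulSn in jn; lia.
rewrite [X in _ * X]big1_seq ?mulr1; last first.
  move=> i; rewrite mem_index_iota => /andP[_ /andP[jki _]].
  by rewrite /F; do 2!case: ltnP => //; lia.
rewrite mut_prob_prod -{1}[(j * k)%N]add0n big_addn addKn big_mkord; apply: eq_bigr => i _.
rewrite /F ltnNge leq_addl /= [(j * k + k)%N]addnC ltn_add2r ltn_ord addnK.
by rewrite bitE ffunE addnC.
Qed.

(** * Comparing fitness values of [LO] *)

Section LOProcess.
Variables (R : realType) (n k : nat) (f : forall m, bits m -> R).
Hypotheses (k_gt0 : (0 < k)%N) (k_dvd : (k %| n)%N).
Hypothesis f_ge0 : forall x : bits k, 0 <= f k x.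
Hypothesis f_opt : forall x : bits k, x != ones k -> f k x < f k (ones k).

Local Notation N := (n %/ k)%N.
Local Notation pre := (@prefix_ones n k).
Local Notation g := (LO n k f).

Lemma f_le_ones (x : bits k) : f k x <= f k (ones k).
Proof. by have [->//|/f_opt/ltW] := eqVneq x (ones k). Qed.

Lemma is_opt_f (x : bits k) : is_opt (f k) x = (x == ones k).
Proof.
apply/forallP/eqP => [H|-> y]; last exact: f_le_ones.
by apply/eqP/negPn/negP => /f_opt; rewrite ltNge H.
Qed.

Lemma blocks_fit j : (j < N)%N -> (j.+1 * k <= n)%N.
Proof. by rewrite -leq_divRL. Qed.

Lemma LO_E (x : bits n) : g x = \sum_(i < N) f k (block k x i) * (pre x i)%:R.
Proof. by apply: eq_bigr => i _; rewrite prod_natb. Qed.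

Lemma prefix_ones_bound (x : bits n) i : pre x i -> (i <= N)%N.
Proof.
move=> /prefix_onesP H; rewrite leqNgt; apply/negP => Ni.
have nik : (n < i * k)%N by rewrite -[ltnLHS](divnK k_dvd) ltn_mul2r k_gt0.
by have := H _ nik; rewrite bit_out.
Qed.

Lemma prefix_ones_full (x : bits n) : pre x N = (x == ones n).
Proof.
apply/prefix_onesP/eqP => [|-> j]; rewrite divnK //; last by rewrite bit_ones.
by move=> H; apply: bitP => j jn; rewrite H // bit_ones jn.
Qed.

Lemma LO_ge (x : bits n) i : pre x i -> i%:R * f k (ones k) <= g x.
Proof.
move=> xi; rewrite LO_E.
rewrite -(big_mkord xpredT (fun i => f k (block k x i) * (pre x i)%:R)).
rewrite (big_cat_nat (n := i)) ?(prefix_ones_bound _ _ xi) //=.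
apply: ler_wpDr; first by apply: sumr_ge0 => j _; rewrite mulr_ge0 ?ler0n.
rewrite (eq_big_nat _ _ (F2 := fun=> f k (ones k))).
  by rewrite sumr_const_nat subn0 mulr_natl.
move=> j /andP[_ ji]; have := prefix_ones_le _ _ _ _ ji xi.
by rewrite prefix_onesS => /andP[-> /eqP ->]; rewrite mulr1.
Qed.

Lemma LO_level (x : bits n) i : (i < N)%N -> pre x i -> ~~ pre x i.+1 ->
  g x = i%:R * f k (ones k) + f k (block k x i).
Proof.
move=> iN xi xSi; rewrite LO_E.
rewrite -(big_mkord xpredT (fun i => f k (block k x i) * (pre x i)%:R)).
rewrite (big_cat_nat (n := i)) ?(ltnW iN) //=.
rewrite [X in _ + X]big_ltn // xi mulr1.
congr (_ + _); last first.
  rewrite big1_seq ?addr0 // => j; rewrite mem_index_iota => /andP[_ /andP[ij _]].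
  suff /negbTE -> : ~~ pre x j by rewrite mulr0.
  by apply: contra xSi; exact: prefix_ones_le.
rewrite (eq_big_nat _ _ (F2 := fun=> f k (ones k))).
  by rewrite sumr_const_nat subn0 mulr_natl.
move=> j /andP[_ ji]; have := prefix_ones_le _ _ _ _ ji xi.
by rewrite prefix_onesS => /andP[-> /eqP ->]; rewrite mulr1.
Qed.

Lemma LO_prefix (x z : bits n) i : pre x i -> g x <= g z -> pre z i.
Proof.
move=> xi; apply: contraTT => /prefix_ones_level[j ji /andP[zj zSj]].
rewrite -ltNge; apply: lt_le_trans (LO_ge _ _ xi).
have jN : (j < N)%N by apply: leq_trans ji (prefix_ones_bound _ _ xi).
rewrite (LO_level _ _ jN) //.
apply: (@lt_le_trans _ _ (j.+1%:R * f k (ones k))); last first.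
  by rewrite ler_wpM2r // ler_nat.
rewrite -natr1 mulrDl mul1r ltrD2l; apply: f_opt.
by move: zSj; rewrite prefix_onesS zj.
Qed.

Lemma LO_le_prefix (x z : bits n) i : ~~ pre x i -> pre z i -> g x <= g z.
Proof.
by move=> xi zi; apply: contraNT xi; rewrite -ltNge => /ltW /(LO_prefix _ _ _ zi).
Qed.

Lemma LO_le_block (x z : bits n) j : (j < N)%N ->
  pre x j -> ~~ pre x j.+1 -> pre z j ->
  (g x <= g z)%R = (f k (block k x j) <= f k (block k z j)).
Proof.
move=> jN xj xSj zj; have [zSj|zSj] := boolP (pre z j.+1).
  rewrite (LO_le_prefix _ _ _ xSj zSj).
  by move: zSj; rewrite prefix_onesS => /andP[_ /eqP ->]; rewrite f_le_ones.
by rewrite (LO_level x j) // (LO_level z j) // lerD2l.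
Qed.

Lemma is_opt_LO (x : bits n) : is_opt g x = pre x N.
Proof.
have oN : pre (ones n) N by rewrite prefix_ones_full.
apply/forallP/idP => [/(_ (ones n))|xN y]; first exact: LO_prefix.
have [yN|yN] := boolP (pre y N); last exact: LO_le_prefix yN xN.
move: xN yN; rewrite !prefix_ones_full => /eqP -> /eqP ->.
exact: lexx.
Qed.

(** * The bits behind the critical block stay uniform *)

Definition clear_upto (c : bits n) i :=
  forall j, (j < i * k)%N -> bit c j = false.

Definition tail_uniform (mu : bits n -> R) := forall i x c,
  ~~ pre x i -> clear_upto c i -> mu (bxor x c) = mu x.

Lemma LO_xor x c i : ~~ pre x i -> clear_upto c i -> g (bxor x c) = g x.
Proof.
move=> xi ci; rewrite !LO_E; apply: eq_bigr => l _.
have [li|il] := ltnP l i.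
  have cl j : (j < l.+1 * k)%N -> bit c j = false.
    by move=> jl; apply: ci; apply: leq_trans jl _; rewrite leq_mul2r li orbT.
  rewrite prefix_ones_xor; last first.
    by move=> j jl; apply: cl; apply: leq_trans jl _; rewrite leq_mul2r leqnSn orbT.
  congr (f k _ * _); apply: bitP => j jk; rewrite !block_bit // bit_xor cl ?addbF //.
  by rewrite mulSn addnC ltn_add2r.
have npre y : ~~ pre y i -> pre y l = false.
  by move=> yi; apply/negbTE; apply: contra yi; exact: prefix_ones_le.
by rewrite !npre ?mulr0 // prefix_ones_xor.
Qed.

Lemma LO_le_xor x z c i : ~~ pre x i -> clear_upto c i ->
  (g (bxor x c) <= g (bxor z c))%R = (g x <= g z).
Proof.
move=> xi ci; rewrite (LO_xor x c i) //.
have [zi|zi] := boolP (pre z i); last by rewrite (LO_xor z c i).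
by rewrite !(LO_le_prefix _ _ _ xi) // prefix_ones_xor.
Qed.

Lemma ea_kernel_xor (p : R) x y c i : ~~ pre x i -> clear_upto c i ->
  ea_kernel p g (bxor x c) (bxor y c) = ea_kernel p g x y.
Proof.
move=> xi ci; rewrite /ea_kernel [LHS](reindex_inj (can_inj (bxorK c))) /=.
apply: eq_bigr => z _; rewrite mut_prob_xor (LO_le_xor x z c i) //.
by rewrite -(fun_if (bxor^~ c)) (inj_eq (can_inj (bxorK c))).
Qed.

Lemma ea_kernel_prefix (p : R) x y i : pre x i -> ~~ pre y i ->
  ea_kernel p g x y = 0.
Proof.
move=> xi yi; apply: big1 => z _; case: eqP => [zy|_]; last exact: mulr0.
move: yi; rewrite -zy; case: ifP => [/(LO_prefix _ _ _ xi) ->//|_].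
by rewrite xi.
Qed.

Lemma nonopt_tail_uniform : tail_uniform (fun x => (~~ is_opt g x)%:R).
Proof.
move=> i x c xi ci; rewrite !is_opt_LO.
have [iN|Ni] := leqP i N.
  have npre y : ~~ pre y i -> pre y N = false.
    by move=> yi; apply/negbTE; apply: contra yi; exact: prefix_ones_le.
  by rewrite !npre // prefix_ones_xor.
rewrite prefix_ones_xor // => j jN; apply: ci; apply: leq_trans jN _.
by rewrite leq_mul2r ltnW ?orbT.
Qed.

Lemma not_hit_tail_uniform (p : R) t : tail_uniform (not_hit p g t).
Proof.
elim: t => [|t IH] i y c yi ci /=; first by rewrite (nonopt_tail_uniform i).
rewrite (nonopt_tail_uniform i) //; congr (_ * _).
rewrite [LHS](reindex_inj (can_inj (bxorK c))); apply: eq_bigr => x _ /=.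
have [xi|xi] := boolP (pre x i); last by rewrite (IH i) // (ea_kernel_xor _ _ _ _ i).
by rewrite !(ea_kernel_prefix _ _ _ i) ?mulr0 // prefix_ones_xor.
Qed.

(** * The potential of the [LO] process *)

Section Potential.
Variables (p : R) (h : bits k -> R).
Hypothesis p01 : 0 < p < 1.
Hypothesis hE : forall b,
  h b = (~~ is_opt (f k) b)%:R * (1 + \sum_b' ea_kernel p (f k) b b' * h b').

Let E := (2 ^+ k)^-1 * \sum_b h b.
Let q j := (1 - p) ^+ (j * k).

(* Expected number of iterations still to be spent with exactly [j] completed
   blocks, when the bits behind the critical block are uniform; each such
   iteration leaves the completed blocks intact with probability [q j]. *)
Definition phi j x := (q j)^-1 * (if pre x j then h (block k x j) else E).

Lemma h_ones : h (ones k) = 0.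
Proof. by rewrite hE is_opt_f eqxx mul0r. Qed.

Lemma q_neq0 j : q j != 0.
Proof. by case/andP: p01 => _ p1; rewrite expf_neq0 // subr_eq0 gt_eqF. Qed.

Lemma phi_done j x : pre x j.+1 -> phi j x = 0.
Proof.
by rewrite prefix_onesS /phi => /andP[-> /eqP ->]; rewrite h_ones mulr0.
Qed.

Lemma phi_drift_reached j x : (j < N)%N -> pre x j ->
  phi j x - \sum_y ea_kernel p g x y * phi j y = 1 - (pre x j.+1)%:R.
Proof.
move=> jN xj; apply: oppr_inj; rewrite opprB ea_kernel_drift.
have [xSj|xSj] := boolP (pre x j.+1).
  rewrite subrr oppr0 big1 // => z _; rewrite (phi_done _ _ xSj).
  have [/(LO_prefix _ _ _ xSj) zSj|] := boolP (g x <= g z)%R.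
    by rewrite phi_done // subr0 !mulr0.
  by rewrite mul0r mulr0.
set bx := block k x j.
have bx1 : bx != ones k by move: xSj; rewrite prefix_onesS xj.
pose G b := (q j)^-1 * ((f k bx <= f k b)%R%:R * (h b - h bx)).
transitivity (\sum_z mut_prob p x z * ((pre z j)%:R * G (block k z j))).
  apply: eq_bigr => z _; congr (_ * _).
  have [zj|zj] := boolP (pre z j).
    by rewrite (LO_le_block _ _ _ jN xj xSj zj) /phi xj zj /G -/bx /=; ring.
  suff /negbTE -> : ~~ (g x <= g z)%R by rewrite !mul0r.
  by apply: contra zj; exact: LO_prefix.
rewrite sum_mut_block ?blocks_fit // -/bx /G.
under eq_bigr do rewrite mulrCA.
rewrite -mulr_sumr -/(q j) mulVKf ?q_neq0 // -ea_kernel_drift [h bx]hE.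
by rewrite is_opt_f bx1 /= mul1r subr0; ring.
Qed.

Lemma phi_drift_unreached j mu : (j < N)%N -> tail_uniform mu ->
  \sum_(x | ~~ pre x j) mu x * (phi j x - \sum_y ea_kernel p g x y * phi j y) = 0.
Proof.
move=> jN muU.
pose W z := (pre z j)%:R * \sum_(x | ~~ pre x j) mu x * mut_prob p x z.
have WU c z : W (bxor z (embed k j c)) = W z.
  have cl : clear_upto (embed k j c) j by move=> l; exact: embed_low.
  rewrite /W prefix_ones_xor //; congr (_ * _).
  rewrite [LHS](reindex_inj (can_inj (bxorK (embed k j c)))) /=.
  apply: eq_big => x; first by rewrite prefix_ones_xor.
  by rewrite prefix_ones_xor // => xj; rewrite mut_prob_xor (muU j).
transitivity (- (q j)^-1 * \sum_z (W z * h (block k z j) - W z * E)).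
  rewrite mulr_sumr.
  under [RHS]eq_bigr do rewrite -mulrBr /W mulrAC [X in _ * X]mulrC mulr_suml mulr_sumr.
  rewrite exchange_big /=; apply: eq_bigr => x xj.
  rewrite -opprB ea_kernel_drift mulrN -mulNr mulr_sumr.
  apply: eq_bigr => z _; have [zj|zj] := boolP (pre z j).
    by rewrite (LO_le_prefix _ _ _ xj zj) /phi zj (negbTE xj) /=; ring.
  by rewrite /phi (negbTE xj) (negbTE zj) subrr /=; ring.
by rewrite sumrB sum_block_uniform ?blocks_fit // -mulr_suml subrr mulr0.
Qed.

Lemma phi_drift j mu : (j < N)%N -> tail_uniform mu ->
  \sum_x mu x * (phi j x - \sum_y ea_kernel p g x y * phi j y)
  = \sum_x mu x * ((pre x j)%:R - (pre x j.+1)%:R).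
Proof.
move=> jN muU; rewrite (bigID (fun x => pre x j)) /= phi_drift_unreached // addr0.
rewrite [RHS](bigID (fun x => pre x j)) /= [X in _ + X]big1 ?addr0.
  by apply: eq_bigr => x xj; rewrite phi_drift_reached // xj.
by move=> x /negbTE xj; rewrite prefix_onesS xj subrr mulr0.
Qed.

Lemma sum_phi j : (j < N)%N -> \sum_x phi j x = (q j)^-1 * (2 ^+ n * E).
Proof.
move=> jN; rewrite -mulr_sumr; congr (_ * _).
have U : forall c z, (pre (bxor z (embed k j c)) j)%:R = (pre z j)%:R :> R.
  by move=> c z; rewrite prefix_ones_xor // => l; exact: embed_low.
transitivity (\sum_x ((pre x j)%:R * h (block k x j) + (~~ pre x j)%:R * E)).
  by apply: eq_bigr => x _; case: (pre x j) => /=; ring.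
rewrite big_split /= (sum_block_uniform _ _ _ (blocks_fit j jN) U) -mulr_suml.
rewrite -mulrDl -big_split /= (eq_bigr (fun=> 1)) => [|x _]; last first.
  by case: (pre x j) => /=; ring.
by rewrite sumr_const card_ffun card_bool card_ord natrX.
Qed.

Lemma expected_runtime_block : expected_runtime p (f k) = E%:E.
Proof.
apply: (expected_runtime_potential _ _ _ (ones k)) => //.
- by rewrite is_opt_f.
- by move=> b; rewrite is_opt_f => /eqP ->; exact: h_ones.
move=> t; apply: eq_bigr => b _.
have [bo|bo] := boolP (is_opt (f k) b); first by rewrite not_hit_opt // mul0r.
by rewrite [h b]hE bo mul1r addrK mulr1.
Qed.

Lemma expected_runtime_LO_phi :
  expected_runtime p g = (E * \sum_(j < N) (q j)^-1)%:E.
Proof.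
rewrite (expected_runtime_potential p g (fun x => \sum_(j < N) phi j x) (ones n)) //.
- rewrite exchange_big /= (eq_bigr (fun j : 'I_N => (q j)^-1 * (2 ^+ n * E))).
    rewrite -mulr_suml mulrCA mulKf ?expf_neq0 ?pnatr_eq0 //.
    by rewrite mulrC.
  by move=> j _; rewrite sum_phi.
- by rewrite is_opt_LO prefix_ones_full.
- move=> x; rewrite is_opt_LO => xN; apply: big1 => j _; apply: phi_done.
  exact: prefix_ones_le xN.
move=> t; set mu := not_hit p g t.
transitivity (\sum_(j < N) \sum_x mu x *
    (phi j x - \sum_y ea_kernel p g x y * phi j y)).
  rewrite exchange_big; apply: eq_bigr => x _ /=; rewrite -mulr_sumr sumrB.
  congr (_ * (_ - _)); rewrite exchange_big; apply: eq_bigr => y _ /=.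
  by rewrite mulr_sumr.
rewrite (eq_bigr (fun j : 'I_N => \sum_x mu x * ((pre x j)%:R - (pre x j.+1)%:R))).
  rewrite exchange_big; apply: eq_bigr => x _ /=; rewrite -mulr_sumr.
  rewrite -(big_mkord xpredT (fun j => (pre x j)%:R - (pre x j.+1)%:R)).
  under eq_bigr do rewrite -opprB.
  rewrite sumrN telescope_sumr // opprB prefix_ones0 -is_opt_LO.
  have [xo|_] := boolP (is_opt g x); last by rewrite subr0 mulr1.
  by rewrite /mu not_hit_opt // mul0r.
by move=> j _; apply: phi_drift => //; exact: not_hit_tail_uniform.
Qed.

End Potential.

Lemma expected_runtime_LO (p : R) : 0 < p < 1 ->
  expected_runtime p g
  = (expected_runtime p (f k) * (\sum_(j < N) ((1 - p) ^+ (j * k))^-1)%:E)%E.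
Proof.
move=> p01; have o1 : is_opt (f k) (ones k) by rewrite is_opt_f.
have [h hE] := hitting_time_exists p (f k) (ones k) p01 o1.
by rewrite (expected_runtime_LO_phi p h) // (expected_runtime_block p h) // EFinM.
Qed.

End LOProcess.

(** * Closed form and asymptotics *)

Lemma inv_subr_natV {R : realType} (n : nat) : (2 <= n)%N ->
  (1 - n%:R^-1)^-1 = n%:R / (n%:R - 1) :> R.
Proof.
move=> n2; have : (2 : R) <= n%:R by rewrite ler_nat.
by move=> ?; field; apply/andP; split; apply/eqP; lra.
Qed.

Lemma sum_geometric_blocks {R : realType} (n k : nat) :
  (2 <= n)%N -> (0 < k)%N -> (k %| n)%N ->
  \sum_(j < n %/ k) ((1 - n%:R^-1) ^+ (j * k))^-1
  = ((n%:R / (n%:R - 1)) ^+ n - 1) / ((n%:R / (n%:R - 1)) ^+ k - 1) :> R.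
Proof.
move=> n2 k0 kn; set r := n%:R / (n%:R - 1).
have r1 : 1 < r.
  have : (2 : R) <= n%:R by rewrite ler_nat.
  by move=> ?; rewrite /r ltr_pdivlMr; lra.
rewrite -[in RHS](divnK kn) mulnC exprM subrX1 mulrAC divff ?mul1r.
  by apply: eq_bigr => j _; rewrite mulnC exprM -!exprVn inv_subr_natV.
by rewrite subr_eq0 gt_eqF // exprn_egt1 // -lt0n.
Qed.

(* Bernoulli's inequality for the exponent [ceil (n / 2)], then squaring. *)
Lemma subr_natV_exp_ge {R : realType} (n : nat) : (2 <= n)%N ->
  16^-1 <= (1 - n%:R^-1) ^+ n :> R.
Proof.
move=> n2; have n2R : (2 : R) <= n%:R by rewrite ler_nat.
set a := n%:R^-1; have na : n%:R * a = 1 by rewrite mulfV //; apply/eqP; lra.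
have a0 : 0 < a by rewrite invr_gt0; lra.
have a1 : a <= 2^-1 by rewrite lef_pV2 ?posrE //; lra.
have bern m : 1 - m%:R * a <= (1 - a) ^+ m.
  elim: m => [|m IH]; first by rewrite mul0r subr0.
  have m0 : 0 <= m%:R * a by rewrite mulr_ge0 ?ler0n ?ltW.
  rewrite exprS -natr1.
  apply: (@le_trans _ _ ((1 - a) * (1 - m%:R * a))); first by nra.
  by rewrite ler_wpM2l //; lra.
pose m := uphalf n.
have mn : (n <= m + m)%N by rewrite addnn /m; lia.
have m2 : (m.*2 <= n.+1)%N by rewrite /m; lia.
have mR : m%:R * 2 <= n%:R + 1 :> R.
  by rewrite natr1 -[2]/(2%:R) -natrM ler_nat muln2.
have am : 4^-1 <= (1 - a) ^+ m by apply: le_trans (bern m); nra.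
apply: (@le_trans _ _ ((1 - a) ^+ (m + m))).
  by rewrite exprD; nra.
by rewrite ler_wiXn2l //; lra.
Qed.

Lemma sum_geometric_blocks_bounds {R : realType} (n k : nat) :
  (2 <= n)%N -> (0 < k)%N -> (k %| n)%N ->
  let s : R := \sum_(j < n %/ k) ((1 - n%:R^-1) ^+ (j * k))^-1 in
  n%:R / k%:R <= s <= 16 * (n%:R / k%:R).
Proof.
move=> n2 k0 kn /=; have n2R : (2 : R) <= n%:R by rewrite ler_nat.
have nk : n%:R / k%:R = (n %/ k)%:R :> R.
  by rewrite -{1}(divnK kn) natrM mulfK // pnatr_eq0 -lt0n.
have a0 : 0 < n%:R^-1 :> R by rewrite invr_gt0; lra.
have a1 : n%:R^-1 <= 2^-1 :> R by rewrite lef_pV2 ?posrE //; lra.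
set s := 1 - n%:R^-1; have s0 : 0 < s by rewrite /s; lra.
have s1 : s <= 1 by rewrite /s; lra.
have cst (c : R) : \sum_(j < n %/ k) c = c * (n %/ k)%:R.
  by rewrite sumr_const card_ord mulr_natr.
rewrite nk; apply/andP; split.
  rewrite -[leLHS]mul1r -cst; apply: ler_sum => j _.
  by rewrite invf_ge1 ?exprn_gt0 // exprn_ile1 // ltW.
rewrite -cst; apply: ler_sum => j _.
rewrite -[leRHS]invrK lef_pV2 ?posrE ?invr_gt0 ?exprn_gt0 //.
apply: le_trans (subr_natV_exp_ge n n2) _; rewrite ler_wiXn2l ?(ltW s0) //.
by rewrite -leq_divRL // ltnW.
Qed.

Theorem theorem1 (R : realType) :
  (forall (n k : nat) (f : forall m, bits m -> R),
     (2 <= n)%N -> (0 < k)%N -> (k %| n)%N ->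
     (forall m (x : bits m), 0 <= f m x) ->
     (forall m (x : bits m), x != ones m -> f m x < f m (ones m)) ->
     expected_runtime n%:R^-1 (LO n k f) =
       (expected_runtime n%:R^-1 (f k) *
        ((((n%:R / (n%:R - 1)) ^+ n - 1) / ((n%:R / (n%:R - 1)) ^+ k - 1))%:E))%E)
  /\
  (exists c1 c2 : R, 0 < c1 /\ 0 < c2 /\
   forall (n k : nat) (f : forall m, bits m -> R),
     (2 <= n)%N -> (0 < k)%N -> (k %| n)%N ->
     (forall m (x : bits m), 0 <= f m x) ->
     (forall m (x : bits m), x != ones m -> f m x < f m (ones m)) ->
     (c1%:E * expected_runtime n%:R^-1 (f k) * (n%:R / k%:R)%:E
        <= expected_runtime n%:R^-1 (LO n k f))%E /\
     (expected_runtime n%:R^-1 (LO n k f)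
        <= c2%:E * expected_runtime n%:R^-1 (f k) * (n%:R / k%:R)%:E)%E).
Proof.
have p01 (n : nat) : (2 <= n)%N -> 0 < (n%:R^-1 : R) < 1.
  move=> n2; have n2R : (2 : R) <= n%:R by rewrite ler_nat.
  by rewrite invr_gt0 invf_lt1; lra.
split=> [n k f n2 k0 kn f0 fo|].
  by rewrite -sum_geometric_blocks // expected_runtime_LO ?p01 //; exact: fo.
exists 1, 16; do 2!split=> //; move=> n k f n2 k0 kn f0 fo.
rewrite expected_runtime_LO ?p01 //; last exact: fo.
have ge0 := expected_runtime_ge0 _ (f k) (p01 n n2).
have /andP[lo hi] := sum_geometric_blocks_bounds (R := R) n k n2 k0 kn.
split; first by rewrite mul1e lee_wpmul2l // lee_fin.
by rewrite [X in (_ <= X * _)%E]muleC -muleA -EFinM lee_wpmul2l // lee_fin.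
Qed.
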